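(* Let $\widehat{O}_t$ be a linear integro-differential operator acting on functions of the variable $t$. Let $R,k$ be real numbers, let $r=k^2$, and let $f$ be a function such that $t\mapsto f(-rt)$ is in the domain of $\widehat{O}_t$ and $$\widehat{O}_t f(-rt) = -r\, f(-rt).$$ Then the function $$u(x,t)=R\,e^{kx} f(-rt)$$ is a solution of the Burgers-type equation $$\widehat{O}_t u+\left(\frac{2u_x}{u}\right)u_x-u_{xx}=0.$$
   Context: Here $u=u(x,t)$ is a function of two real variables, and subscripts $x$ denote partial derivatives in $x$. The operator $\widehat{O}_t$ is a general linear operator (for instance a differential, integral or fractional operator) acting only on the $t$ variable: for a function $u(x,t)$, $\widehat{O}_t u$ is obtained by applying $\widehat{O}_t$ to $t\mapsto u(x,t)$ for each fixed $x$, so that factors depending only on $x$ are treated as constants. The equality $\widehat{O}_t f(-rt)=-rf(-rt)$ means that the function $t\mapsto f(-rt)$ is an eigenfunction of $\widehat{O}_t$ with eigenvalue $-r$. Because of the quotient $u_x/u$, the equation is understood at points where $u\neq 0$. *)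

(* Defs.v *)
From HB Require Import structures.
From mathcomp Require Import all_boot all_order all_algebra.
From mathcomp Require Import all_classical all_reals all_analysis.
Set Implicit Arguments.
Unset Strict Implicit.
Unset Printing Implicit Defensive.
Import Order.TTheory GRing.Theory Num.Theory.
Import numFieldNormedType.Exports.
Local Open Scope ring_scope.
Local Open Scope classical_set_scope.

(* A linear operator, possibly only defined on a linear subspace [opdom] of
   the functions of the variable [t]. The values of [opfun] outside [opdom]
   are junk: nothing is assumed about them. *)
Record linear_operator (R : realType) := LinearOperator {
  opdom : set (R -> R);
  opfun :> (R -> R) -> (R -> R);
  opdom0 : opdom (fun _ => 0);
  opdom_linear : forall (a : R) (g h : R -> R),
    opdom g -> opdom h -> opdom (fun t => a * g t + h t);
  opfun_linear : forall (a : R) (g h : R -> R),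
    opdom g -> opdom h ->
    forall t, opfun (fun t => a * g t + h t) t = a * opfun g t + opfun h t
}.

(* [u x t] is the value at space [x] and time [t], so that [u x] is the
   function of [t] to which an operator in [t] is applied, and [u ^~ t] is the
   function of [x] which is differentiated. *)
Definition partial_x (R : realType) (u : R -> R -> R) : R -> R -> R :=
  fun x t => (u ^~ t)^`() x.

(* The equation is required where [u] does not vanish, because of the quotient
   [u_x / u]. Membership in the domain of [O] and existence of [u_x] and
   [u_xx] are required everywhere: [opfun] and [derive1] are total and would
   otherwise return junk. *)
Definition burgers_solution (R : realType) (O : linear_operator R)
    (u : R -> R -> R) : Prop :=
  let u_x := partial_x u in
  let u_xx := partial_x u_x in
  [/\ forall x, opdom O (u x),
      forall x t, derivable (u ^~ t) x 1,
      forall x t, derivable (u_x ^~ t) x 1 &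
      forall x t, u x t != 0 ->
        O (u x) t + (2 * u_x x t / u x t) * u_x x t - u_xx x t = 0].

(* Main.v *)
Require Import Defs.
From HB Require Import structures.
From mathcomp Require Import all_boot all_order all_algebra.
From mathcomp Require Import all_classical all_reals all_analysis.
From mathcomp Require Import ring.
Set Implicit Arguments.
Unset Strict Implicit.
Unset Printing Implicit Defensive.
Import Order.TTheory GRing.Theory Num.Theory.
Import numFieldNormedType.Exports.
Local Open Scope ring_scope.
Local Open Scope classical_set_scope.

(** Write u for the candidate R e^(kx) f(-rt), the amplitude being called C
    below. For fixed x it is a constant multiple of t |-> f(-rt), so linearity
    turns the eigenvalue relation into O_t u = - r u = - k^2 u. For fixed t it is
    a multiple of x |-> e^(kx), so u_x = k u and u_xx = k^2 u, and wherever u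
    does not vanish the nonlinear term is (2 u_x / u) u_x = 2 k^2 u. The three
    contributions - k^2 u + 2 k^2 u - k^2 u cancel. The two ingredients are
    [opfunZ] and [is_derive_expR_profile]. *)

Section LinearOperator.
Variables (R : realType) (O : linear_operator R).

Lemma opfun0 t : O (fun _ => 0) t = 0.
Proof.
have := opfun_linear 1 (opdom0 O) (opdom0 O) t.
under eq_fun do rewrite mulr0 addr0.
by rewrite mul1r => /eqP; rewrite -subr_eq subrr eq_sym => /eqP.
Qed.

Lemma opdomZ a g : opdom O g -> opdom O (fun t => a * g t).
Proof.
move=> Og; have := opdom_linear a Og (opdom0 O).
by under eq_fun do rewrite addr0.
Qed.

Lemma opfunZ a g t : opdom O g -> O (fun t => a * g t) t = a * O g t.
Proof.
move=> Og; have := opfun_linear a Og (opdom0 O) t.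
by rewrite opfun0 addr0; under eq_fun do rewrite addr0.
Qed.

End LinearOperator.

(** The derivative is written as k times the function itself, so that the same
    lemma, used with amplitude k * a, also gives the second derivative. *)
Lemma is_derive_expR_profile (R : realType) (a k b x : R) :
  is_derive x 1 (fun y : R => a * expR (k * y) * b) (k * a * expR (k * x) * b).
Proof.
have dexp : is_derive x 1 (fun y : R => expR (k * y)) (k * expR (k * x)).
  have dk : is_derive x 1 ( *%R k : R -> R) k.
    by apply: is_derive_eq; rewrite -[_ *: _]/(_ * _) mulr1.
  have := is_derive1_comp (is_derive_expR (k * x)) dk.
  by rewrite mulrC.
have -> : (fun y : R => a * expR (k * y) * b) =
    (a * b) \*: (fun y : R => expR (k * y)).
  by apply/funext => y /=; rewrite -[_ *: _]/(_ * _) mulrAC.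
apply: is_derive_eq.
by rewrite -[_ *: _]/(_ * _); ring.
Qed.

Lemma partial_x_expR_profile (R : realType) (a k : R) (g : R -> R) :
  partial_x (fun x t => a * expR (k * x) * g t) =
  fun x t => k * a * expR (k * x) * g t.
Proof.
apply/funext => x; apply/funext => t; rewrite /partial_x derive1E.
by have [] := is_derive_expR_profile a k (g t) x.
Qed.

Theorem proposition2p1 (R : realType) (O : linear_operator R)
    (C k r : R) (hr : r = k ^+ 2) (f : R -> R)
    (hdom : opdom O (fun t => f (- r * t)))
    (heig : forall t, O (fun t => f (- r * t)) t = - r * f (- r * t)) :
  burgers_solution O (fun x t => C * expR (k * x) * f (- r * t)).
Proof.
rewrite /burgers_solution !(partial_x_expR_profile _ _ (fun t => f (- r * t))).
split=> [x|x t|x t|x t u_neq0].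
- exact: opdomZ.
- by have [] := is_derive_expR_profile C k (f (- r * t)) x.
- by have [] := is_derive_expR_profile (k * C) k (f (- r * t)) x.
- rewrite opfunZ // heig.
  (* As an atom, u can be cancelled in the quotient. *)
  set u := C * expR (k * x) * f (- r * t) in u_neq0 *.
  have -> : C * expR (k * x) * (- r * f (- r * t)) = - k ^+ 2 * u.
    by rewrite /u {1}hr; ring.
  have -> : k * C * expR (k * x) * f (- r * t) = k * u by rewrite /u; ring.
  have -> : k * (k * C) * expR (k * x) * f (- r * t) = k ^+ 2 * u.
    by rewrite /u; ring.
  by field.
Qed.
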